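(* Let $\Delta^n$ be the $n$-dimensional simplex, let $0\le k\le n$ be an integer, and let $X_1,\ldots,X_N\subset\Delta^n$ be closed subsets such that for every $i$ there is a facet of $\Delta^n$ that $X_i$ does not intersect. If no $k+1$ of the sets $X_1,\ldots,X_N$ have a common point (that is, $\bigcap_{i\in I}X_i=\emptyset$ for every $I\subseteq\{1,\ldots,N\}$ with $|I|=k+1$), then there exists a connected component of the complement $\Delta^n\setminus\bigcup_{i=1}^N X_i$ that intersects every $k$-dimensional face of $\Delta^n$.
   Context: A facet of $\Delta^n$ is a face of dimension $n-1$; a $k$-face is a closed face of dimension $k$ (for $k=n$ the only such face is $\Delta^n$ itself). *)

(* Defs.v *)
From mathcomp Require Import all_boot all_order all_algebra.
From mathcomp Require Import all_classical all_reals all_analysis.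
Set Implicit Arguments.
Unset Strict Implicit.
Unset Printing Implicit Defensive.
Import Order.TTheory GRing.Theory Num.Theory.
Import numFieldNormedType.Exports.
Local Open Scope classical_set_scope.
Local Open Scope ring_scope.

(* Delta^n, in barycentric coordinates, with the subspace topology of R^(n+1). *)
Definition simplex (R : realType) (n : nat) : set 'rV[R]_n.+1 :=
  [set x | (forall i, 0 <= x 0 i) /\ \sum_i x 0 i = 1].

(* The closed face spanned by the vertices with index in S, of dimension
   #|S| - 1. *)
Definition face (R : realType) (n : nat) (S : {set 'I_n.+1}) :
    set 'rV[R]_n.+1 :=
  [set x | simplex x /\ forall i, i \notin S -> x 0 i = 0].

Definition is_face (R : realType) (n k : nat) (F : set 'rV[R]_n.+1) : Prop :=
  exists2 S : {set 'I_n.+1}, #|S| = k.+1 & F = face S.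

(* Dimension n - 1, i.e. n vertices.  For n = 0 the only facet is the empty
   face, of dimension -1. *)
Definition is_facet (R : realType) (n : nat) (F : set 'rV[R]_n.+1) : Prop :=
  exists2 S : {set 'I_n.+1}, #|S| = n & F = face S.

Definition is_component (T : topologicalType) (A C : set T) : Prop :=
  exists2 x, A x & C = connected_component A x.

(* Main.v *)
Require Import Defs.
From mathcomp Require Import all_boot all_order all_algebra.
From mathcomp Require Import all_classical all_reals all_analysis.
From mathcomp Require Import zify ring lra.
Set Implicit Arguments.
Unset Strict Implicit.
Unset Printing Implicit Defensive.
Import Order.TTheory GRing.Theory Num.Theory.
Import numFieldNormedType.Exports.

(* Suppose every component C of the complement misses a k-face S(C).  Label a
   point x of a fine lattice in the simplex as follows: if x is close to some
   X_i, by the vertex opposite to a facet missed by X_i; otherwise x lies in a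
   component C and outside the face S(C), and its label is a vertex in the
   support of x but not in S(C).  This is a Sperner labelling, so n+1 lattice
   points close to each other carry all n+1 labels.  The X_i close to these
   points have a common point, so at most k labels are of the first kind; the
   points of the second kind are joined by segments avoiding all X_i, hence lie
   in one component C, which leaves at most n-k labels outside S(C).

   Sperner's lemma is derived, without triangulations, from Scarf's lemma on
   several linear orders of a finite set, which is proved by double counting. *)

(** * Combinatorics: the lemmas of Scarf and Sperner *)

Section Sperner.
Import mathcomp.boot.fintype mathcomp.boot.finset.

(** Exactly one collision [f x = f y] occurs on [D], so the points removable without shrinking the
    image are [x] and [y]. *)
Lemma card_removable (aT rT : finType) (f : aT -> rT) (D : {set aT}) :
  #|D| = #|f @: D|.+1 -> #|[set x in D | f @: (D :\ x) == f @: D]| = 2.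
Proof.
move=> cD.
have [x [y [xD yD xy fxy]]] : exists x y, [/\ x \in D, y \in D, x != y & f x = f y].
  have : ~~ [forall x in D, forall y in D, (f x == f y) ==> (x == y)].
    apply/negP => /forall_inP h.
    have : #|f @: D| = #|D|.
      apply: card_in_imset => x y xD yD fxy.
      by have /forall_inP/(_ y yD)/implyP := h x xD; rewrite fxy => /(_ (eqxx _))/eqP.
    lia.
  rewrite negb_forall_in => /exists_inP[x xD].
  rewrite negb_forall_in => /exists_inP[y yD].
  by rewrite negb_imply => /andP[/eqP fxy xy]; exists x, y.
have imx : f @: (D :\ x) = f @: D.
  apply/eqP; rewrite eqEsubset imsetS ?subD1set //=.
  apply/subsetP => _ /imsetP[z zD ->].
  have [->|zx] := eqVneq z x; last by apply: imset_f; rewrite !inE zx.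
  by rewrite fxy; apply: imset_f; rewrite !inE eq_sym xy.
have imy : f @: (D :\ y) = f @: D.
  apply/eqP; rewrite eqEsubset imsetS ?subD1set //=.
  apply/subsetP => _ /imsetP[z zD ->].
  have [->|zy] := eqVneq z y; last by apply: imset_f; rewrite !inE zy.
  by rewrite -fxy; apply: imset_f; rewrite !inE xy.
have inj : {in D :\ x &, injective f}.
  by apply/imset_injP; rewrite imx; have := cardsD1 x D; rewrite xD cD add1n => -[->].
suff -> : [set z in D | f @: (D :\ z) == f @: D] = [set x; y] by rewrite cards2 xy.
apply/setP => z; rewrite !inE; apply/andP/orP; last first.
  by case=> /eqP->; rewrite ?imx ?imy ?eqxx ?xD ?yD.
case=> zD /eqP imz; have [|zx] := eqVneq z x; [by left|right].
have : f z \in f @: (D :\ z) by rewrite imz imset_f.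
case/imsetP => w; rewrite !inE => /andP[wz wD] fzw.
have [wx|wx] := eqVneq w x.
  by apply/eqP; apply: inj; rewrite ?inE ?zx ?(eq_sym y) ?xy // fzw wx.
by move: wz; rewrite (inj w z) ?eqxx // !inE ?wx ?zx.
Qed.

(** * Scarf's lemma for a finite family of linear orders *)

Section Scarf.
Variables (T I : finType) (key : I -> T -> nat).
Hypothesis key_inj : forall i, injective (key i).

(** No point lies strictly above the least element of [D] in every order at once; those of full size
    [#|I|] are Scarf's primitive sets. *)
Definition dominated (D : {set T}) :=
  [forall x, exists i, forall y in D, key i x <= key i y].

Lemma dominatedP (D : {set T}) :
  reflect (forall x, exists i, forall y, y \in D -> key i x <= key i y)
          (dominated D).
Proof.
apply: (iffP forallP) => h x.
  by have /existsP[i /forall_inP] := h x; exists i.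
by have [i hi] := h x; apply/existsP; exists i; apply/forall_inP.
Qed.

Lemma dominatedS (D E : {set T}) : D \subset E -> dominated E -> dominated D.
Proof.
move=> /subsetP DE /dominatedP h; apply/dominatedP => x.
by have [i hi] := h x; exists i => y /DE/hi.
Qed.

Definition least (t0 : T) (D : {set T}) i := [arg min_(y < t0 in D) key i y].

Lemma least_in t0 (D : {set T}) i : t0 \in D -> least t0 D i \in D.
Proof. by move=> tD; rewrite /least; case: arg_minnP. Qed.

Lemma least_le t0 (D : {set T}) i y : t0 \in D -> y \in D ->
  key i (least t0 D i) <= key i y.
Proof. by move=> tD; rewrite /least; case: arg_minnP => // z _; apply. Qed.

Lemma least_uniq t0 (D : {set T}) i y : t0 \in D -> y \in D ->
  (forall z, z \in D -> key i y <= key i z) -> least t0 D i = y.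
Proof.
move=> tD yD h; apply: (key_inj (i := i)); apply/eqP; rewrite eqn_leq.
by rewrite least_le //= h // least_in.
Qed.

(** Domination applied to a member [x] of [D] gives an order in which [x] itself is least. *)
Lemma least_dominated t0 (D : {set T}) : t0 \in D -> dominated D ->
  least t0 D @: [set: I] = D.
Proof.
move=> tD /dominatedP h; apply/setP => x; apply/imsetP/idP.
  by case=> i _ ->; exact: least_in.
by move=> xD; have [i hi] := h x; exists i; rewrite // (@least_uniq _ _ _ x).
Qed.

(* A dominated set with one element less than there are orders extends in
   exactly two ways: one for each of the two orders sharing their least
   element, by the greatest element that lies above the least elements of all
   the other orders. *)
Lemma card_extensions (D : {set T}) : #|I| = #|D|.+1 -> D != set0 ->
  dominated D ->
  (forall i, exists x, forall j, j != i -> exists2 y, y \in D & key j y < key j x) ->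
  #|[set x | (x \notin D) && dominated (x |: D)]| = 2.
Proof.
move=> cI /set0Pn[t0 t0D] domD above.
pose mn := least t0 D.
have mnI : mn @: [set: I] = D by apply: least_dominated.
pose P := [set i in [set: I] | mn @: ([set: I] :\ i) == mn @: [set: I]].
have cP : #|P| = 2 by apply: card_removable; rewrite mnI cardsT.
pose M i := [pred x | [forall (j | j != i), key j (mn j) < key j x]].
have aboveM i : exists x, M i x.
  have [x hx] := above i; exists x; apply/forall_inP => j ji.
  have [y yD] := hx j ji; apply: leq_ltn_trans; exact: least_le.
pose w i := xchoose (aboveM i).
have wM i : M i (w i) by apply: xchooseP.
pose h i := [arg max_(x > w i | M i x) key i x].
have hM i : M i (h i) by rewrite /h; case: arg_maxnP.
have hmax i y : M i y -> key i y <= key i (h i).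
  by rewrite /h; case: arg_maxnP => // x _; apply.
have hnot i : i \in P -> h i \notin D.
  rewrite !inE mnI /= => /eqP imD; apply/negP; rewrite -{1}imD => /imsetP[j].
  rewrite !inE andbT => ji hE; have /forall_inP/(_ j ji) := hM i.
  by rewrite hE ltnn.
(* Domination of [h i] by [D] must come from order [i], as [h i] lies above the least elements of
   all other orders. *)
have hlow i : key i (h i) <= key i (mn i).
  have /dominatedP/(_ (h i))[j] := domD.
  have [->|ji] := eqVneq j i => hj; first by apply: hj; apply: least_in.
  have /forall_inP/(_ j ji) := hM i; rewrite ltnNge hj //; exact: least_in.
(* [h] is injective on [P]: a common value [h i = h j] with [i != j] would lie strictly above the
   least element in every order. *)
rewrite -cP -(card_in_imset (f := h) (D := P)); last first.
  move=> i j _ _ hij; apply/eqP/negPn/negP => ij.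
  have /dominatedP/(_ (h i))[l hl] := domD.
  have : key l (mn l) < key l (h i).
    have [li|li] := eqVneq l i; last by have /forall_inP/(_ l li) := hM i.
    by rewrite hij; have /forall_inP := hM j; apply; rewrite li.
  by rewrite ltnNge hl //; apply: least_in.
congr #|pred_of_set _|; apply/setP => x; rewrite !inE; apply/andP/imsetP; last first.
  case=> i iP ->; split; first exact: hnot.
  apply/dominatedP => y.
  have [yM|] := boolP (M i y).
    exists i => z; rewrite !inE => /orP[/eqP->|zD]; first exact: hmax.
    exact: leq_trans (hmax _ _ yM) (leq_trans (hlow i) (least_le _ t0D zD)).
  rewrite negb_forall_in => /exists_inP[j ji]; rewrite -leqNgt => yj.
  exists j => z; rewrite !inE => /orP[/eqP->|zD].
    by apply: leq_trans yj (ltnW _); have /forall_inP/(_ j ji) := hM i.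
  exact: leq_trans yj (least_le _ t0D zD).
(* Least elements match the orders one to one with the points of [x |: D]. So [x] is least in a
   single order [i], and each other order keeps its least element [mn j]. *)
case=> xD dom.
have x0 : x \in x |: D by rewrite !inE eqxx.
have imE : least x (x |: D) @: [set: I] = x |: D by apply: least_dominated.
have injE : injective (least x (x |: D)).
  have : {in [set: I] &, injective (least x (x |: D))}.
    by apply/imset_injP; rewrite imE cardsT cardsU1 xD cI.
  by move=> inj i j; apply: inj; rewrite inE.
have /imsetP[i _ xi] : x \in least x (x |: D) @: [set: I] by rewrite imE.
have mnE j : j != i -> least x (x |: D) j = mn j.
  move=> ji; symmetry; apply: least_uniq => //.
    have : least x (x |: D) j \in x |: D by apply: least_in.
    rewrite !inE => /orP[/eqP lx|//].
    by move: ji; rewrite (injE _ _ (etrans lx xi)) eqxx.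
  by move=> z zD; apply: least_le => //; rewrite !inE zD orbT.
have xM : M i x.
  apply/forall_inP => j ji; rewrite ltn_neqAle -mnE // least_le // andbT.
  apply: contraNneq xD => /key_inj {1}<-; rewrite mnE //; exact: least_in.
exists i.
  rewrite !inE /= eqEsubset imsetS ?subsetT //= mnI.
  apply/subsetP => z zD; have : z \in x |: D by rewrite !inE zD orbT.
  rewrite -imE => /imsetP[j _ zj].
  have ji : j != i.
    by apply: contraNneq xD => ji; rewrite xi -ji -zj.
  by rewrite zj mnE //; apply: imset_f; rewrite !inE ji.
apply: (key_inj (i := i)); apply/eqP; rewrite eqn_leq hmax //=.
have /dominatedP/(_ (h i))[j] := dom.
have [->|ji] := eqVneq j i => hj; first exact: hj.
have /forall_inP/(_ j ji) := hM i.
by rewrite ltnNge hj // -mnE //; exact: least_in.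
Qed.

(* Double counting of the pairs (D, E), where D is a dominated set of full size,
   E is D minus one point and c maps E onto all colours but [i0].  Given D, the
   number of E is odd iff D has all colours; given E, the number of D is even,
   except for the set of all slacks but [s i0]. *)
Lemma scarf_slack (s : I -> T) (c : T -> I) (i0 : I) (a0 : T) :
  injective s -> (forall i, c (s i) = i) -> a0 \notin codom s ->
  (forall i x, x != s i -> key i (s i) < key i x) ->
  (forall i j x, j != i -> x \notin codom s -> key i x < key i (s j)) ->
  exists D : {set T}, [/\ #|D| = #|I|, dominated D & c @: D = [set: I]].
Proof.
move=> s_inj cs a0s s_lo s_hi.
pose room := [pred D : {set T} | (#|D| == #|I|) && dominated D].
pose door := [pred D : {set T} | (#|D|.+1 == #|I|) && (c @: D == [set~ i0])].
pose inc (D E : {set T}) := [exists x, (x \notin E) && (D == x |: E)].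
have I_gt0 : 0 < #|I| by apply/card_gt0P; exists i0.
have cardsC1' : #|[set~ i0]|.+1 = #|I| by rewrite cardsC1 prednK.
have roomE D : room D ->
    odd (\sum_(E | door E) inc D E) = (c @: D == [set: I]).
  move=> /andP[/eqP cD domD].
  have -> : \sum_(E | door E) inc D E = #|[set x in D | c @: (D :\ x) == [set~ i0]]|.
    rewrite -big_mkcondr /= sum1_card -(card_in_imset (f := fun x => D :\ x)).
      apply: eq_card => E; apply/idP/imsetP.
        rewrite unfold_in => /andP[/andP[/eqP cE /eqP lE] /existsP[x /andP[xE /eqP DE]]].
        exists x; first by rewrite inE DE setU1K // lE eqxx !inE eqxx.
        by rewrite DE setU1K.
      case=> x; rewrite inE => /andP[xD /eqP lE] ->.
      rewrite unfold_in lE eqxx andbT; apply/andP; split.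
        by rewrite -cD (cardsD1 x D) xD add1n.
      by apply/existsP; exists x; rewrite !inE eqxx /= setD1K.
    move=> x y; rewrite !inE => /andP[xD _] /andP[yD _] /setP/(_ y).
    rewrite !inE yD eqxx /= andbT; case: eqVneq => //= -> //.
  (* With all colours present, only the point coloured [i0] can go; with exactly the colours other
     than [i0], [card_removable] gives two points; otherwise there is none. *)
  have [cDT|cDT] := eqVneq (c @: D) [set: I].
    have inj : {in D &, injective c}.
      by apply/imset_injP; rewrite cDT cardsT cD.
    have /imsetP[x xD xi] : i0 \in c @: D by rewrite cDT inE.
    suff -> : [set x in D | c @: (D :\ x) == [set~ i0]] = [set x] by rewrite cards1.
    apply/setP => y; rewrite !inE; apply/andP/eqP.
      case=> yD /eqP imE; apply/eqP/negPn/negP => yx.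
      have : c x \in c @: (D :\ y) by apply: imset_f; rewrite !inE eq_sym yx.
      by rewrite imE !inE xi eqxx.
    move=> ->; split=> //; apply/eqP/setP => i; rewrite !inE; apply/imsetP/idP.
      case=> z; rewrite !inE => /andP[zx zD] ->; apply: contra zx.
      by rewrite xi => /eqP/(inj _ _ zD xD)->.
    move=> ii; have /imsetP[z zD zi] : i \in c @: D by rewrite cDT inE.
    exists z => //; rewrite !inE zD andbT; apply: contra ii => /eqP zx.
      by rewrite zi zx -xi.
  have [cDi|cDi] := eqVneq (c @: D) [set~ i0].
    by rewrite -cDi card_removable // cDi cD.
  rewrite (_ : [set _ in _ | _] = set0) ?cards0 //.
  apply/setP => x; rewrite !inE; apply/negP => /andP[xD /eqP imE].
  have : [set~ i0] \subset c @: D by rewrite -imE imsetS ?subD1set.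
  move=> sub; have [i0D|i0D] := boolP (i0 \in c @: D).
    move: cDT; rewrite -subTset => /negP; apply; apply/subsetP => i _.
    have [->//|ii] := eqVneq i i0.
    by move/subsetP: sub; apply; rewrite !inE.
  move: cDi; rewrite eqEsubset sub andbT => /negP; apply.
  by apply/subsetP => i iD; rewrite !inE; apply: contraNneq i0D => <-.
pose D0 := [set s i | i in [set~ i0]].
have doorE E : door E -> odd (\sum_(D | room D) inc D E) = (E == D0).
  move=> /andP[/eqP cE /eqP lE].
  have -> : \sum_(D | room D) inc D E = #|[set x | (x \notin E) && dominated (x |: E)]|.
    rewrite -big_mkcondr /= sum1_card -(card_in_imset (f := fun x => x |: E)).
      apply: eq_card => D; apply/idP/imsetP.
        rewrite unfold_in => /andP[/andP[/eqP cD dD] /existsP[x /andP[xE /eqP DE]]].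
        by exists x => //; rewrite inE xE -DE.
      case=> x; rewrite inE => /andP[xE dom] ->.
      rewrite unfold_in dom cardsU1 xE add1n cE eqxx /=.
      by apply/existsP; exists x; rewrite xE /=.
    move=> x y; rewrite !inE => /andP[xE _] /andP[yE _] /setP/(_ x).
    by rewrite !inE eqxx (negbTE xE) !orbF => /esym/eqP.
  have [->|ED0] := eqVneq E D0.
    (* The only completion of [D0] is by the greatest non-slack in order [i0]. The slack [s i0]
       fails, since the set of all slacks leaves [a0] undominated. *)
    pose a := [arg max_(x > a0 | x \notin codom s) key i0 x].
    have aP : a \notin codom s /\ forall y, y \notin codom s -> key i0 y <= key i0 a.
      by rewrite /a; case: arg_maxnP.
    have D0P x : x \in D0 -> exists2 i, i != i0 & x = s i.
      by case/imsetP => i; rewrite !inE; exists i.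
    have sD0 i : i != i0 -> s i \in D0 by move=> ii; apply: imset_f; rewrite !inE.
    have D0s x : x \notin codom s -> x \notin D0.
      by apply: contra => /D0P[i _ ->]; apply: codom_f.
    case: aP => aS amax.
    suff -> : [set x | (x \notin D0) && dominated (x |: D0)] = [set a].
      by rewrite cards1.
    apply/setP => x; rewrite !inE; apply/andP/eqP; last first.
      move=> ->; split; first exact: D0s.
      apply/dominatedP => y.
      have [yS|yS] := boolP (y \in codom s).
        have /codomP[i ->] := yS; exists i => z _.
        by have [->//|/s_lo/ltnW] := eqVneq z (s i).
      exists i0 => z; rewrite !inE => /orP[/eqP->|/D0P[i ii ->]]; first exact: amax.
      by apply/ltnW/s_hi.
    case=> xD0 /dominatedP dom.
    have xS : x \notin codom s.
      apply/negP => /codomP[i xi]; have ii : i = i0.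
        by apply/eqP; apply: contraNT xD0; rewrite xi; apply: sD0.
      have [j hj] := dom a0.
      have /hj : s j \in x |: D0.
        rewrite !inE; have [->|ji] := eqVneq j i0; first by rewrite xi ii eqxx.
        by rewrite sD0 ?orbT.
      by rewrite leqNgt s_lo //; apply: contraNneq a0s => ->; apply: codom_f.
    apply: (key_inj (i := i0)); apply/eqP; rewrite eqn_leq amax //=.
    have [j] := dom a; have [->|ji] := eqVneq j i0 => hj.
      by apply: hj; rewrite !inE eqxx.
    have /hj : s j \in x |: D0 by rewrite !inE sD0 ?orbT.
    by rewrite leqNgt s_lo //; apply: contraNneq aS => ->; apply: codom_f.
  have [domE|domE] := boolP (dominated E); last first.
    rewrite (_ : [set _ | _] = set0) ?cards0 //.
    apply/setP => x; rewrite !inE; apply: contraNF domE => /andP[_].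
    by apply: dominatedS; rewrite subsetUr.
  (* Slacks carry their own colours, so a door made of slacks is [D0]. A non-slack [z] puts [s i]
     above some element of [E] in every order but [i], as [card_extensions] demands. *)
  have [z zE zS] : exists2 z, z \in E & z \notin codom s.
    apply/exists_inP; apply: contraNT ED0.
    rewrite negb_exists_in => /forall_inP h; apply/eqP/setP => x.
    apply/idP/imsetP.
      move=> xE; have := h x xE; rewrite negbK => /codomP[i xi].
      by exists i => //; rewrite -lE -(cs i) -xi imset_f.
    case=> i; rewrite -lE => /imsetP[y yE ->] ->.
    by have := h y yE; rewrite negbK => /codomP[j yj]; rewrite yj cs -yj.
  rewrite card_extensions ?cE //; first by apply/set0Pn; exists z.
  by move=> i; exists (s i) => j ji; exists z => //; apply: s_hi => //; rewrite eq_sym.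
have doorD0 : door D0.
  rewrite /= card_imset // cardsC1' eqxx /=; apply/eqP/setP => i.
  apply/imsetP/idP => [[_ /imsetP[j jP ->] ->]|iP]; first by rewrite cs.
  by exists (s i); rewrite ?cs // imset_f.
have : odd (\sum_(D | room D) \sum_(E | door E) inc D E).
  rewrite exchange_big /= (bigD1 D0) //= oddD doorE // eqxx /=.
  elim/big_ind: _ => // [x y|E /andP[dE ED0]]; last by rewrite doorE // (negbTE ED0).
  by rewrite oddD => /negbTE-> /negbTE->.
have [/exists_inP[D /andP[/eqP cD dD] /eqP lD]|] :=
  boolP [exists (D | room D), c @: D == [set: I]].
  by move=> _; exists D.
rewrite negb_exists_in => /forall_inP none.
suff /negbTE-> : ~~ odd (\sum_(D | room D) \sum_(E | door E) inc D E) by [].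
elim/big_ind: _ => // [x y|D rD]; last by rewrite roomE // none.
by rewrite oddD => /negbTE-> /negbTE->.
Qed.
End Scarf.

(* The slack [inr i] is below everything in the order [i] and above all of [A]
   in the other orders, so it stands for an order not used by [D]. *)
Lemma scarf (A I : finType) (key : I -> A -> nat) (c : A -> I) (a0 : A) :
  (forall i, injective (key i)) ->
  exists D : {set A}, forall x, exists2 i, i \in c @: D &
    forall y, y \in D -> key i x <= key i y.
Proof.
move=> key_inj.
pose M := (\max_i \max_a key i a).+2.
have keyM i a : (key i a).+1 < M.
  rewrite !ltnS; apply: leq_trans (leq_bigmax (F := key i) a) _.
  exact: leq_bigmax i.
pose key' i (t : A + I) := match t with
  | inl a => (key i a).+1
  | inr j => if j == i then 0 else M + enum_rank j end.
pose c' (t : A + I) := match t with inl a => c a | inr j => j end.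
have key'_inj i : injective (key' i).
  move=> [a|j] [b|l] /=.
  - by case=> /key_inj ->.
  - by case: ifP => // _ E; have := keyM i a; lia.
  - by case: ifP => // _ E; have := keyM i b; lia.
  - case: (j =P i) => [->|_]; case: (l =P i) => [->|_] //; try by have := keyM i a0; lia.
    by move=> /addnI E; congr inr; apply/enum_rank_inj/ord_inj.
have inrP x : x \notin codom (@inr A I) -> exists a, x = inl a.
  by case: x => [a|j]; [exists a|rewrite codom_f].
have [|||||D [_ /dominatedP domD cD]] :=
  @scarf_slack _ _ key' key'_inj inr c' (c a0) (inl a0).
- by move=> i j [].
- by [].
- by apply/codomP => -[].
- move=> i [a|j] /=; rewrite eqxx // => ji; case: (j =P i) ji => [->|_ _].
    by rewrite eqxx.
  by have := keyM i a0; lia.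
- move=> i j x ji /inrP[a ->] /=; rewrite (negbTE ji).
  by have := keyM i a; lia.
exists [set a | inl a \in D] => x.
have [i hi] := domD (inl x).
(* The slack [inr i] has key 0 in order [i], below [inl x]; hence colour [i] must come from a point
   of [A]. *)
have niD : inr i \notin D.
  by apply/negP => /hi /=; rewrite eqxx.
exists i; last by move=> y; rewrite inE => /hi /=.
have : i \in c' @: D by rewrite cD inE.
case/imsetP => -[a|j] aD /= ij; last by rewrite ij aD in niD.
by rewrite ij; apply: imset_f; rewrite inE.
Qed.

(** * Base-[B] expansions and cyclic lexicographic orders *)

Lemma digits_lt B n (x : 'I_n -> nat) :
  (forall j, x j < B) -> \sum_(j < n) x j * B ^ j < B ^ n.
Proof.
elim: n x => [|n IHn] x xB; first by rewrite big_ord0.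
rewrite big_ord_recr expnS /=.
have := IHn _ (fun j => xB (widen_ord (leqnSn n) j)).
by have /= := xB ord_max; nia.
Qed.

Lemma digits_inj B n (x y : 'I_n -> nat) :
  (forall j, x j < B) -> (forall j, y j < B) ->
  \sum_(j < n) x j * B ^ j = \sum_(j < n) y j * B ^ j -> x =1 y.
Proof.
elim: n x y => [|n IHn] x y xB yB; first by move=> _ [].
have B_gt0 : 0 < B by apply: leq_ltn_trans (xB ord0).
rewrite !big_ord_recl !muln1.
have shift (z : 'I_n.+1 -> nat) : \sum_(i < n) z (lift ord0 i) * B ^ bump 0 i =
    (\sum_(i < n) z (lift ord0 i) * B ^ i) * B.
  by rewrite big_distrl; apply: eq_bigr => i _; rewrite /= expnSr mulnA.
rewrite /= !shift => E.
have E0 : x ord0 = y ord0.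
  by have := congr1 (modn^~ B) E; rewrite /= ![_ + _ * B]addnC !modnMDl !modn_small.
have E1 := IHn _ _ (fun j => xB (lift ord0 j)) (fun j => yB (lift ord0 j)).
move=> j; case: (unliftP ord0 j) => [j' ->|-> //]; apply: E1.
by move: E; rewrite E0 => /addnI /eqP; rewrite eqn_pmul2r // => /eqP.
Qed.

Section CyclicOrder.
Variables (n B : nat).
Implicit Types (i j : 'I_n.+1) (x y : {ffun 'I_n.+1 -> 'I_B}).

(* The position of [j] in the list [i - 1, i - 2, ..., 0, n, ..., i + 1, i]. *)
Definition rank_nat i j := if i <= j then n - (j - i) else i - j - 1.

Lemma rank_nat_ord i j : rank_nat i j < n.+1.
Proof. by rewrite /rank_nat; case: ifP; have := ltn_ord i; lia. Qed.

Definition rank i j : 'I_n.+1 := Ordinal (rank_nat_ord i j).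

Lemma rank_inj i : injective (rank i).
Proof.
move=> j l /(congr1 val); rewrite /= /rank_nat => E; apply/ord_inj.
by move: E (ltn_ord i) (ltn_ord j) (ltn_ord l); do 2!case: ifP; lia.
Qed.

Lemma rank_self i : rank i i = ord_max.
Proof. by apply/ord_inj; rewrite /= /rank_nat leqnn subnn subn0. Qed.

(* Lexicographic comparison of x_i, x_(i+1), ..., x_n, x_0, ..., x_(i-1). *)
Definition lexkey i x := \sum_j x j * B ^ rank i j.

Lemma lexkeyE i x :
  lexkey i x = \sum_p x (invF (@rank_inj i) p) * B ^ p.
Proof.
rewrite /lexkey (reindex_inj (can_inj (f_invF (@rank_inj i)))).
by apply: eq_bigr => p _; rewrite f_invF.
Qed.

Lemma lexkey_inj i : injective (lexkey i).
Proof.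
move=> x y; rewrite !lexkeyE => /digits_inj E; apply/ffunP => j.
apply/ord_inj; rewrite -(invF_f (@rank_inj i) j); exact: E.
Qed.

(** Coordinate [i] has the top rank [n], so it is the leading digit. *)
Lemma lexkey_lt i x y : x i < y i -> lexkey i x < lexkey i y.
Proof.
move=> xy; have top (z : {ffun 'I_n.+1 -> 'I_B}) : lexkey i z =
    \sum_(p < n) z (invF (@rank_inj i) (widen_ord (leqnSn n) p)) * B ^ p
    + z i * B ^ n.
  by rewrite lexkeyE big_ord_recr /= -[in z (invF _ _)](rank_self i) invF_f.
have := @digits_lt B n (fun p => x (invF (@rank_inj i) (widen_ord (leqnSn n) p)))
  (fun=> ltn_ord _).
by rewrite !top /=; nia.
Qed.

(** Here y = x - e_j + e_l, written without subtraction; moving a unit to a digit of higher rank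
    changes the key by a positive difference of powers of [B]. *)
Lemma lexkey_move i j l x y : 1 < B -> rank i j < rank i l ->
  (forall p, y p + (p == j) = x p + (p == l)) -> lexkey i x < lexkey i y.
Proof.
move=> B_gt1 jl E.
have delta q : \sum_p (p == q) * B ^ rank i p = B ^ rank i q.
  rewrite (bigD1 q) //= eqxx mul1n big1 ?addn0 // => p /negbTE ->.
  by rewrite mul0n.
have : lexkey i y + B ^ rank i j = lexkey i x + B ^ rank i l.
  rewrite -(delta j) -(delta l) -!big_split; apply: eq_bigr => p _ /=.
  by rewrite -!mulnDl E.
have lt_pow : B ^ rank i j < B ^ rank i l by rewrite ltn_exp2l.
by move=> E'; rewrite -(ltn_add2r (B ^ rank i l)) -E' ltn_add2l.
Qed.

End CyclicOrder.

(** * Sperner's lemma on lattice points *)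

Lemma ffun_of_sum n m (x : 'I_n.+1 -> nat) : \sum_j x j = m ->
  exists y : {ffun 'I_n.+1 -> 'I_m.+1}, forall j, y j = x j :> nat.
Proof.
move=> xm; exists [ffun j => inord (x j)] => j; rewrite ffunE inordK //.
by rewrite ltnS -xm (bigD1 j) //= leq_addr.
Qed.

(** Scarf's lemma for the cyclic lexicographic orders gives a dominating set [D]. Points of [D]
    vanish off the colours of [D], which forces all labels to occur; and no lattice point exceeds
    all coordinatewise minima of [D], which bounds its spread by [n]. *)
Lemma sperner n m (L : {ffun 'I_n.+1 -> 'I_m.+1} -> 'I_n.+1) :
  (forall a : {ffun 'I_n.+1 -> 'I_m.+1}, \sum_j a j = m -> 0 < a (L a)) ->
  exists f : 'I_n.+1 -> {ffun 'I_n.+1 -> 'I_m.+1},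
    [/\ forall i, \sum_j f i j = m, forall i, L (f i) = i
      & forall i j l, f i l <= f j l + n].
Proof.
move=> L_gt0.
pose A := {a : {ffun 'I_n.+1 -> 'I_m.+1} | \sum_j a j == m}.
have mkA (x : 'I_n.+1 -> nat) : \sum_j x j = m ->
    exists a : A, forall j, val a j = x j :> nat.
  move=> xm; have [y yx] := ffun_of_sum xm.
  have ym : \sum_j y j == m by apply/eqP; rewrite -[RHS]xm; apply: eq_bigr.
  by exists (exist _ y ym).
have sumA (a : A) : \sum_j val a j = m by apply/eqP/(valP a).
have [a0 _] : exists a : A, forall j, val a j = m * (j == ord0) :> nat.
  apply: mkA; rewrite (bigD1 ord0) //= muln1 big1 ?addn0 // => j /negbTE ->.
  by rewrite muln0.
(* This makes the base [m.+1] at least 2, as [lexkey_move] requires. *)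
have m_gt0 : 0 < m.
  by have := L_gt0 _ (sumA a0); have := ltn_ord (val a0 (L (val a0))); lia.
pose key i (a : A) := lexkey i (val a).
have key_inj i : injective (key i) by move=> x y /lexkey_inj/val_inj.
(* The labels are shifted cyclically because [C] then contains its own shift,
   which forces it to be everything. *)
have [D domD] := scarf (fun a : A => ordS (L (val a))) a0 key_inj.
set C := imset _ _ in domD.
have [i1 i1C _] := domD a0.
have support y j : y \in D -> j \notin C -> val y j = 0 :> nat.
  move=> yD jC; apply/eqP; rewrite -leqn0 leqNgt; apply/negP => yj.
  (* [l] is the last index of [C] cyclically before [j], so every order in [C] reads [l] before [j].
     Moving a unit of [y] from [j] to [l] would increase all these keys, against domination. *)
  pose l := [arg max_(l > i1 in C) rank l j].
  have [lC lmax] : l \in C /\ forall i, i \in C -> rank i j <= rank l j.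
    by rewrite /l; case: arg_maxnP.
  have lj : l != j by apply: contraNneq jC => <-.
  have [y' y'E] : exists y' : A, forall p,
      val y' p = val y p - (p == j) + (p == l) :> nat.
    apply: mkA; rewrite big_split /=.
    rewrite [X in _ + X](bigD1 l) //= eqxx [X in 1 + X]big1 => [|p /negbTE->//].
    have := sumA y; rewrite (bigD1 j) //= => ym.
    rewrite [in LHS](bigD1 j) //= eqxx.
    rewrite (eq_bigr (fun p => val y p : nat)) => [|p /negbTE->]; last by rewrite subn0.
    by rewrite -[RHS]ym /= -addnA [_ + (1 + 0)]addnC addn0 addnA subnK.
  have [i iC hi] := domD y'; have := hi y yD; rewrite leqNgt => /negP; apply.
  apply: (@lexkey_move _ _ _ j l); first by [].
    have := lmax i iC; move: lj; rewrite /= /rank_nat -(inj_eq val_inj) /=.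
    by move: (ltn_ord i) (ltn_ord j) (ltn_ord l); do ?case: ifP; lia.
  move=> p; rewrite y'E; case: (p =P j) => [->|_]; last by rewrite subn0 addn0.
  by rewrite addnAC subnK.
have C_pred i : i \in C -> ord_pred i \in C.
  case/imsetP => y yD ->; rewrite ordSK; apply/negPn/negP => LC.
  by have := L_gt0 _ (sumA y); rewrite (support y).
have C_down k (i j : 'I_n.+1) : i = j + k :> nat -> i \in C -> j \in C.
  elim: k i => [|k IHk] i; first by rewrite addn0 => /ord_inj ->.
  move=> ij /C_pred; apply: IHk; rewrite /= ij.
  rewrite (_ : (j + k.+1 + n.+1).-1 = j + k + n.+1); last by lia.
  by rewrite modnDr modn_small //; have := ltn_ord i; lia.
(* Stepping down from [i1] reaches 0, whose cyclic predecessor is [n]; stepping down from [n]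
   reaches every index. *)
have CT i : i \in C.
  have C0 : ord0 \in C by apply: (C_down i1 i1).
  apply: (C_down (n - i) ord_max) => /=; first by have := ltn_ord i; lia.
  suff <- : ord_pred ord0 = ord_max :> 'I_n.+1 by apply: C_pred.
  by apply/ord_inj; rewrite /= modn_small.
have fP i : exists y, (y \in D) && (L (val y) == i).
  have /imsetP[y yD E] : ordS i \in C := CT _.
  exists y; rewrite yD; apply/eqP; apply: (can_inj (@ordSK _)); exact: esym E.
pose f i := xchoose (fP i).
have fD i : f i \in D by have /andP[] := xchooseP (fP i).
have fL i : L (val (f i)) = i by have /andP[_ /eqP] := xchooseP (fP i).
exists (fun i => val (f i)); split=> // i j l.
pose low p : A := [arg min_(y < f i in D) val y p].
have lowP p : low p \in D /\ forall y, y \in D -> val (low p) p <= val y p.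
  by rewrite /low; case: arg_minnP.
(* Otherwise some lattice point exceeds every minimum, with the excess put on coordinate 0, and so
   beats [low p] in order [p] for each [p]. *)
have sum_low : m < \sum_p (val (low p) p).+1.
  rewrite ltnNge; apply/negP => small.
  have [x xE] : exists x : A, forall p, val x p =
      (val (low p) p).+1 + (m - \sum_p (val (low p) p).+1) * (p == ord0) :> nat.
    apply: mkA; rewrite big_split /= [X in _ + X](bigD1 ord0) //= muln1.
    by rewrite [X in _ + (_ + X)]big1 => [|p /negbTE ->]; rewrite ?muln0 // addn0 subnKC.
  have [p _ hp] := domD x; have [lD _] := lowP p.
  have := hp _ lD; rewrite leqNgt => /negP; apply; apply: lexkey_lt.
  by rewrite xE addSn ltnS leq_addr.
move: sum_low; rewrite -(eq_bigr _ (fun p _ => addn1 _)) big_split /=.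
rewrite sum1_card card_ord [X in _ < X + _](bigD1 l) //=.
have := sumA (f i); rewrite (bigD1 l) //=.
have : \sum_(p < n.+1 | p != l) val (low p) p <= \sum_(p < n.+1 | p != l) val (f i) p.
  by apply: leq_sum => p _; have [_] := lowP p; apply.
have [_ /(_ _ (fD j))] := lowP l.
(* The coordinate [f i l] is [m] minus the other coordinates, hence at most [m] minus their minima,
   which by [sum_low] is at most the minimum at [l] plus [n]. *)
have bound a b c d e k : a <= c -> b <= d -> e + d = m -> m < a + b + k.+1 ->
    e <= c + k by lia.
exact: bound.
Qed.
End Sperner.

(** * Compactness and the geometry of the simplex *)

Local Open Scope classical_set_scope.
Local Open Scope ring_scope.

Lemma subset_of_card (T : finType) (A : {set T}) k :
  (k <= #|A|)%N -> exists2 B : {set T}, B \subset A & #|B| = k.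
Proof.
move=> kA; exists [set x in take k (enum A)]%SET.
  by apply/fintype.subsetP => x; rewrite inE => /mem_take; rewrite mem_enum.
rewrite cardsE; have /card_uniqP-> := take_uniq k (enum_uniq A).
by rewrite size_take_min -cardE; apply/minn_idPl.
Qed.

(** A Lebesgue number argument: if [Q z] holds on the ball of radius [r] about [z], then [z] serves
    all [x] within r/2 of it and all radii below r/2. *)
Lemma compact_uniform_radius (R : realType) (M : pseudoMetricType R)
    (K : set M) (Q : M -> M -> Prop) :
  compact K -> (forall z, K z -> \forall y \near z, Q z y) ->
  exists2 e : R, 0 < e &
    forall x, K x -> exists2 z, K z & forall y, ball x e y -> Q z y.
Proof.
move=> /compact_near_coveringP cptK Qnear.
have : \forall e \near 0^'+, K `<=` [set x | exists2 z, K z &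
    forall y, ball x e y -> Q z y].
  apply: cptK => z Kz; have [r /= r0 rQ] : nbhs_ball z (Q z).
    by apply/nbhs_ballP; exact: Qnear.
  have r20 : 0 < r / 2 by rewrite divr_gt0.
  exists (ball z (r / 2), [set e | e < r / 2]) => /=.
    by split; [exact: nbhsx_ballx | exact: nbhs_right_lt].
  move=> [x e] /= [zx er]; exists z => // y xy; apply: rQ.
  by apply: (ball_split zx); apply: le_ball xy; exact: ltW.
move=> nearK; have [e [e0 eK]] := filter_ex (filterI (nbhs_right_gt (0 : R)) nearK).
by exists e.
Qed.

Lemma segment_component (R : realType) (V : normedModType R) (A : set V) x y :
  (forall t : R, 0 <= t <= 1 -> A (x + t *: (y - x))) ->
  connected_component A x y.
Proof.
move=> segA; pose f (t : R) := x + t *: (y - x).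
apply: (@connected_component_max _ _ (f @` `[0, 1])).
- by exists 0; rewrite /= ?in_itv /= ?lexx ?ler01 // /f scale0r addr0.
- by move=> z [t] + <-; rewrite /= in_itv => /segA.
- apply: connected_continuous_connected; first exact: segment_connected.
  apply: continuous_subspaceT => t; apply: cvgD; first exact: cvg_cst.
  by apply: cvgZr_tmp; exact: cvg_id.
- by exists 1; rewrite /= ?in_itv /= ?lexx ?ler01 // /f scale1r addrC subrK.
Qed.

Lemma simplex_compact (R : realType) n : compact (@simplex R n).
Proof.
have -> : @simplex R n =
    [set v | forall i, `[0, 1]%classic (v ord0 i)] `&`
    (fun v => \sum_i v 0 i) @^-1` [set 1].
  apply/seteqP; split=> [x [x_ge0 x1]|x [x01 x1]]; split=> // i.
    rewrite /= in_itv /= x_ge0 -x1 (bigD1 i) //= lerDl.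
    by apply: sumr_ge0 => j _.
  by have := x01 i; rewrite /= in_itv => /andP[].
apply: compact_closedI.
  apply: (@rV_compact R n.+1 (fun=> `[0, 1]%classic)) => i.
  exact: segment_compact.
apply: preimage_closed; last exact: closed_eq.
move=> x _; apply: (@cvg_big _ _ +%R 0 xpredT (@add_continuous R) _ (nbhs x)) => i _.
exact: coord_continuous.
Qed.

(** * Lattice points and segments in the simplex *)

Section LatticePoint.
Variables (R : realType) (n m : nat).
Implicit Types a b : {ffun 'I_n.+1 -> 'I_m.+2}.

(** The mesh is 1/(m+1), so the denominator never vanishes; coordinates up to m+1 need the type
    ['I_m.+2]. *)
Definition lattice_point a : 'rV[R]_n.+1 := \row_j ((a j)%:R / m.+1%:R).

Lemma lattice_point_simplex a :
  (\sum_j a j = m.+1)%N -> simplex (lattice_point a).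
Proof.
move=> am; split=> [i|]; first by rewrite mxE divr_ge0.
under eq_bigr do rewrite mxE.
by rewrite -big_distrl -natr_sum am /= divff // pnatr_eq0.
Qed.

Lemma lattice_point_gt0 a j : (0 < lattice_point a 0 j) = (0 < a j)%N.
Proof. by rewrite mxE pmulr_lgt0 ?invr_gt0 ?ltr0n // ltr0n. Qed.

Lemma lattice_point_ball a b (d : nat) (e : R) : d%:R / m.+1%:R < e ->
  (forall j, a j <= b j + d)%N -> (forall j, b j <= a j + d)%N ->
  ball (lattice_point a) e (lattice_point b).
Proof.
move=> de ab ba; split=> [|i j]; first by apply: le_lt_trans de; rewrite divr_ge0.
rewrite /ball /= !mxE -mulrBl normrM.
rewrite [X in _ * X]ger0_norm ?invr_ge0 //; apply: le_lt_trans de.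
have lea : (a j)%:R <= (b j)%:R + d%:R :> R by rewrite -natrD ler_nat.
have leb : (b j)%:R <= (a j)%:R + d%:R :> R by rewrite -natrD ler_nat.
by rewrite ler_wpM2r ?invr_ge0 // ler_norml; apply/andP; split; lra.
Qed.
End LatticePoint.

Lemma simplex_convex (R : realType) n (x y : 'rV[R]_n.+1) (t : R) :
  simplex x -> simplex y -> 0 <= t <= 1 -> simplex (x + t *: (y - x)).
Proof.
move=> [x0 x1] [y0 y1] /andP[t0 t1]; split=> [i|].
  rewrite !mxE (_ : _ + _ = (1 - t) * x 0 i + t * y 0 i); last by ring.
  by rewrite addr_ge0 // mulr_ge0 // subr_ge0.
under eq_bigr do rewrite !mxE.
by rewrite big_split /= -mulr_sumr sumrB x1 y1 subrr mulr0 addr0.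
Qed.

Lemma ball_segment (R : realType) n (x y : 'rV[R]_n.+1) (t e : R) :
  ball x e y -> 0 <= t <= 1 -> ball x e (x + t *: (y - x)).
Proof.
move=> [e0 xy] /andP[t0 t1]; split=> // i j; have := xy i j; rewrite /ball /= !mxE.
rewrite opprD addNKr normrN normrM (ger0_norm t0) distrC => yx.
by apply: le_lt_trans yx; rewrite ler_piMl.
Qed.

Lemma face_setC_gt0 (R : realType) n (S : {set 'I_n.+1}) (x : 'rV[R]_n.+1) :
  simplex x -> ~ face S x -> exists2 j, j \notin S & 0 < x 0 j.
Proof.
move=> sx nfx; apply: contrapT => none; apply: nfx; split=> // j jS.
have [x_ge0 _] := sx; apply/eqP; rewrite eq_le x_ge0 andbT leNgt.
by apply/negP => xj; apply: none; exists j.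
Qed.

(** * Contradiction from components that each miss a [k]-face *)

Theorem theorem2p1 (R : realType) (n k N : nat) (hk : (k <= n)%N)
    (X : 'I_N -> set 'rV[R]_n.+1)
    (Xclosed : forall i, closed (X i))
    (Xsub : forall i, X i `<=` @simplex R n)
    (Xfacet : forall i, exists2 F, is_facet F & X i `&` F = set0)
    (Xcap : forall I : {set 'I_N}, #|I| = k.+1 ->
       \bigcap_(i in [set` I]) X i = set0) :
  exists2 C : set 'rV[R]_n.+1,
    is_component (@simplex R n `\` \bigcup_(i in [set: 'I_N]) X i) C &
    forall F : set 'rV[R]_n.+1, is_face k F -> C `&` F !=set0.
Proof.
apply: contrapT => noC.
set U := @simplex R n `\` _ in noC.
(* The empty set is a default for sets that are not components. *)
have /choice[S SP] (C : set 'rV[R]_n.+1) : exists S : {set 'I_n.+1},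
    is_component U C -> #|S| = k.+1 /\ C `&` face S = set0.
  have [compC|] := pselect (is_component U C); last by exists finset.set0.
  have /existsNP[F /not_implyP[[S cS ->] /set0P/negP]] :
      ~ forall F, is_face k F -> C `&` F !=set0.
    by move=> h; apply: noC; exists C.
  by rewrite negbK => /eqP CS; exists S.
(* The missed facet has [n] of the [n.+1] vertices; [v i] is the remaining one. *)
have /choice[v vP] (i : 'I_N) : exists j, forall x, X i x -> 0 < x 0 j.
  have [_ [F cF ->] XF] := Xfacet i.
  have /set0Pn[j] : (~: F)%SET != finset.set0.
    rewrite -card_gt0; have := cardsC F; rewrite cF card_ord; lia.
  rewrite inE => jF; exists j => x Xx.
  have nfx : ~ face F x by move=> fx; suff : (X i `&` face F) x by rewrite XF.
  have [l lF xl] := face_setC_gt0 (Xsub i x Xx) nfx.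
  suff -> : j = l by [].
  have /cards1P[p Fp] : #|~: F|%SET == 1%N.
    by apply/eqP; have := cardsC F; rewrite cF card_ord; lia.
  have : (j \in ~: F)%SET /\ (l \in ~: F)%SET by rewrite !inE.
  by rewrite Fp !inE => -[/eqP-> /eqP->].
(* Near [z] only sets [X i] through [z] are met. Once the radius [e] is uniform, all [X i] meeting
   one [e]-ball share a point [z]. *)
have near_e z : @simplex R n z ->
    \forall y \near z, forall i, (X i y -> X i z) /\ (X i z -> 0 < y 0 (v i)).
  move=> _; apply: (@filter_forall _ _
    (fun i y => (X i y -> X i z) /\ (X i z -> 0 < y 0 (v i))) (nbhs z)) => i.
  have [Xz|nXz] := pselect (X i z).
    have pos : \forall y \near z, 0 < (y : 'rV_n.+1) 0 (v i).
      exact: (@cvgr_gt R _ (nbhs z) _ (fun y : 'rV_n.+1 => y 0 (v i)) _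
        (@coord_continuous R 1 n.+1 0 (v i) z) _ (vP i z Xz)).
    by apply: (filterS _ pos) => y.
  have away : \forall y \near z, (~` X i) y.
    by apply: open_nbhs_nbhs; split=> //; apply: closed_openC.
  by apply: (filterS _ away) => y.
have [e e0 eP] := compact_uniform_radius (@simplex_compact R n) near_e.
have e20 : 0 < e / 2 by rewrite divr_gt0.
have ball2 (x y : 'rV[R]_n.+1) : ball x (e / 2) y -> ball x e y.
  by apply: le_ball; lra.
(* The spread [n] of [sperner] then costs less than e/2; the other half of [e] is left for the
   distance to the [X i]. *)
pose m := Num.bound (n%:R / (e / 2)).
have me : n%:R / m.+1%:R < e / 2.
  rewrite ltr_pdivrMr ?ltr0n // mulrC -ltr_pdivrMr //.
  have nonneg : 0 <= n%:R / (e / 2) by rewrite divr_ge0 // ltW.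
  by apply: lt_trans (archi_boundP nonneg) _; rewrite ltr_nat.
pose pt := @lattice_point R n m.
pose close x i := exists2 y, X i y & ball x (e / 2) y.
have closeN x : simplex x -> (forall i, ~ close x i) -> U x.
  move=> sx far; split=> // -[i _ Xx]; apply: (far i); exists x => //.
  exact: ballxx.
pose label_ok x l := (exists2 i, close x i & v i = l) \/
  (forall i, ~ close x i) /\ l \notin S (connected_component U x).
have /choice[L LP] (a : {ffun 'I_n.+1 -> 'I_m.+2}) : exists l,
    (\sum_j a j = m.+1)%N -> (0 < a l)%N /\ label_ok (pt a) l.
  have [am|] := pselect (\sum_j a j = m.+1)%N; last by exists ord0.
  have sa := lattice_point_simplex R am; rewrite -/(pt a) in sa.
  have [[i cli]|far] := pselect (exists i, close (pt a) i).
    exists (v i) => _; split; last by left; exists i.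
    (* [X i] meets the [e]-ball about the lattice point, so it contains [z]; hence coordinate [v i]
       is positive on the whole ball, its centre included. *)
    have [z _ zP] := eP _ sa; have [y Xy ya] := cli.
    rewrite -(lattice_point_gt0 R); have [_] := zP _ (ballxx _ e0) i; apply.
    by have [+ _] := zP _ (ball2 _ _ ya) i; apply.
  have {}far i : ~ close (pt a) i by move=> cli; apply: far; exists i.
  have Ua := closeN _ sa far.
  have [] := SP (connected_component U (pt a)); first by exists (pt a).
  move=> _ CS0; have nfa : ~ face (S (connected_component U (pt a))) (pt a).
    move=> fa; have : (connected_component U (pt a) `&`
      face (S (connected_component U (pt a)))) (pt a).
      by split=> //; apply: connected_component_refl.
    by rewrite CS0.
  have [j jS aj] := face_setC_gt0 sa nfa; exists j => _.
  by rewrite -(lattice_point_gt0 R); split=> //; right.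
have [f [fm fL fd]] := sperner (fun a am => (LP a am).1).
pose x l := pt (f l).
have sx l : simplex (x l) by apply: lattice_point_simplex.
have xok l : label_ok (x l) l by have [_] := LP _ (fm l); rewrite fL.
have xball j l : ball (x j) (e / 2) (x l) by apply: lattice_point_ball me _ _ => p.
pose P := [set l : 'I_n.+1 | `[< exists2 i, close (x l) i & v i = l >]]%SET.
(* Every [X i] close to some [x l] meets the [e]-ball about [x ord0], so it contains one common [z];
   by [Xcap] at most [k] indices do, and [v] maps them onto a set containing [P]. *)
have cP : (#|P| <= k)%N.
  have [z _ zP] := eP _ (sx ord0).
  pose J := [set i | `[< X i z >]]%SET.
  have PJ : P \subset v @: J.
    apply/fintype.subsetP => l; rewrite inE => /asboolP[i [y Xy xy] <-].
    apply: imset_f; rewrite inE; apply/asboolP.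
    by have [+ _] := zP _ (ball_split (xball ord0 l) xy) i; apply.
  apply: leq_trans (subset_leq_card PJ) (leq_trans (leq_imset_card _ _) _).
  rewrite leqNgt; apply/negP => /subset_of_card[I IJ cI].
  have : (\bigcap_(i in [set` I]) X i) z.
    move=> i /= iI; have := fintype.subsetP IJ i iI.
    by rewrite inE => /asboolP.
  by rewrite Xcap.
have farP l : l \notin P ->
    (forall i, ~ close (x l) i) /\ l \notin S (connected_component U (x l)).
  by rewrite inE => /asboolP; have [|] := xok l.
have /set0Pn[l0] : (~: P)%SET != finset.set0.
  by rewrite -card_gt0; have := cardsC P; rewrite card_ord; lia.
rewrite inE => l0P; have [far0 _] := farP _ l0P.
have U0 := closeN _ (sx l0) far0.
have [cS _] : _ := SP (connected_component U (x l0)) (ex_intro2 _ _ _ U0 erefl).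
(* The segment from [x l0] to [x l] stays within e/2 of [x l0], where there is no point of any
   [X i]; both ends thus lie in one component. *)
have PS : (~: P)%SET \subset (~: S (connected_component U (x l0)))%SET.
  apply/fintype.subsetP => l; rewrite 2!finset.in_setC => lP.
  have [_] := farP _ lP.
  congr (_ \notin S _); apply/esym/same_connected_component/segment_component.
  move=> t t01; have st := simplex_convex (sx l0) (sx l) t01.
  split=> // -[i _ Xi]; apply: (far0 i); exists (x l0 + t *: (x l - x l0)) => //.
  exact: ball_segment.
have := cardsC (S (connected_component U (x l0))); have := cardsC P.
rewrite cS card_ord => cardP cardS; have := subset_leq_card PS.
(* At least n+1-k labels lie outside [P], but only n-k vertices lie outside the face. *)
have count p p' s : (p <= k -> p + p' = n.+1 -> k.+1 + s = n.+1 -> ~ p' <= s)%N.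
  by lia.
exact: count cP cardP cardS.
Qed.
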